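(* For any 2-connected graph $G$ with $n$ vertices, $$\mathit{rc}(G) \leq \left\lceil \frac n2 \right\rceil .$$
   Context: Graphs are finite, undirected and simple. A colouring of $G$ means an edge-colouring, which is not assumed to be proper. A subgraph of $G$ is rainbow (with respect to a colouring $c$) if no two of its edges have the same colour under $c$. The edge-coloured graph $(G,c)$ is rainbow-connected if every pair of vertices of $G$ is joined by a rainbow path. The rainbow connection number $\mathit{rc}(G)$ of $G$ is the least number of colours in a colouring of $G$ which makes $G$ rainbow-connected. *)

(* Defs.v *)
From mathcomp Require Import all_boot.
From mathcomp Require Import boolp.

Set Implicit Arguments.
Unset Strict Implicit.
Unset Printing Implicit Defensive.

Record sgraph := SGraph {
  vertex :> finType;
  adj : rel vertex;
  adj_sym : symmetric adj;
  adj_irrefl : irreflexive adj }.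

Section Graph.
Variable G : sgraph.

Definition edges : {set {set G}} :=
  [set [set uv.1; uv.2] | uv : G * G & adj uv.1 uv.2].

Definition edge : finType := {A : {set G} | A \in edges}.

(* The subgraph induced by [A] is connected. *)
Definition connected_in (A : {set G}) : Prop :=
  {in A &, forall x y,
    connect [rel u v | [&& u \in A, v \in A & adj u v]] x y}.

Definition k_connected (k : nat) : Prop :=
  k < #|G| /\ forall X : {set G}, #|X| < k -> connected_in (~: X).

(* [x :: p] is the vertex sequence of a path, without repeated vertices. *)
Definition is_path (x y : G) (p : seq G) : Prop :=
  [/\ path (@adj G) x p, last x p = y & uniq (x :: p)].

Definition path_edges (x : G) (p : seq G) : {set edge} :=
  [set f : edge | val f \in pairmap (fun u v => [set u; v]) x p].

Definition rainbow (C : Type) (c : edge -> C) (F : {set edge}) : Prop :=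
  {in F &, injective c}.

Definition rainbow_connected (C : Type) (c : edge -> C) : Prop :=
  forall x y : G, exists p : seq G, is_path x y p /\ rainbow c (path_edges x p).

Definition rainbow_colourable (k : nat) : Prop :=
  exists c : edge -> 'I_k, rainbow_connected c.

Definition rainbow_colourableb (k : nat) : bool := `[< rainbow_colourable k >].

(* If [G] is disconnected then no colouring makes it rainbow-connected, and [rc]
   takes a default value exceeding the number of edges; see [rcP]. *)
Definition rc : nat :=
  match pselect (exists k, rainbow_colourableb k) with
  | left ex => ex_minn ex
  | right _ => #|edge|.+1
  end.

Lemma connected_colourable :
  connected_in setT -> rainbow_colourable #|edge|.
Proof.
move=> conG; exists (@enum_rank edge) => x y.
have /connectP [p0 pth0 ->] := conG x y (in_setT x) (in_setT y).
case: (shortenP pth0) => p pth up _.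
exists p; split; first last.
  by move=> f g _ _; exact: enum_rank_inj.
split=> //; apply: sub_path pth => u v.
by rewrite /= !in_setT.
Qed.

Lemma rcP : connected_in setT ->
  rainbow_colourable rc /\ forall k, rainbow_colourable k -> rc <= k.
Proof.
move=> conG; rewrite /rc; case: pselect => [ex|]; last first.
  by case; exists #|edge|; apply/asboolP; exact: connected_colourable.
case: ex_minnP => m /asboolP mP minm; split=> // k kP.
by apply: minm; apply/asboolP.
Qed.

Lemma k_connected_connected k : 0 < k -> k_connected k -> connected_in setT.
Proof. by move=> k0 [_ /(_ set0)]; rewrite cards0 setC0; apply. Qed.

End Graph.

Arguments rc : clear implicits.
Arguments k_connected : clear implicits.

(* Main.v *)
Require Import Defs.
From mathcomp Require Import all_boot.
From mathcomp Require Import zify.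

Set Implicit Arguments.
Unset Strict Implicit.
Unset Printing Implicit Defensive.

(* Induction on the number of vertices, over all vertex sets A inducing a
   2-connected subgraph or a single edge, with k = ceil(|A|/2) colours. A pair
   of vertices misses a colour if some rainbow walk joins them without it.
   The colouring is built for prescribed vertices:
   - |A| even: for all r and s <> t, one of the pairs (r,s), (r,t) misses a
     colour;
   - |A| odd: for all q, r and s <> t, moreover, one and the same colour can be
     avoided on the way from q to every vertex.
   Since the coloured vertices are prescribed first, one may pick an ear
   decomposition of A adapted to them, and colour only its last ear, with inner
   vertices v_1, ..., v_h attached at a and b. Up to one or two colours in the
   middle, the two halves of the ear repeat the same sequence of new colours.
   If h is even this costs h/2 colours. If |A| becomes odd there is one spare
   colour x, put next to the middle of the ear; the middle vertex is reached
   from q without x through an edge whose colour is missed by (q,a) or (q,b).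
   If |A| becomes even again by an odd ear, this ear starts with an edge at a
   whose colour is the one avoidable from a, which saves a colour. *)

(** * Rainbow walks and ears *)

(* Membership hypotheses would make [lia] take minutes. *)
Ltac nat_lia := repeat match goal with
  | H : context [in_mem _ _] |- _ => clear H
  | H : @eq (Finite.sort _) _ _ |- _ => clear H
  end; lia.

Section Walks.
Variable G : sgraph.
Implicit Types (A B : {set G}) (c : G -> G -> nat) (S T : pred nat).
Implicit Types (x y z u v : G) (p q : seq G).

Definition adj_in A : rel G := [rel u v | [&& u \in A, v \in A & adj u v]].

Lemma adj_in_sym A : symmetric (adj_in A).
Proof. by move=> u v; rewrite /adj_in /= adj_sym andbCA. Qed.

Lemma adj_inS A B u v : A \subset B -> adj_in A u v -> adj_in B u v.
Proof. by move=> /subsetP AB /and3P[/AB uB /AB vB uv]; apply/and3P. Qed.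

(* Unlike in [is_path], vertices may be repeated; see [shorten_walk]. *)
Definition rainbow_walk c A S x y : Prop :=
  exists p, [/\ path (adj_in A) x p, last x p = y,
                uniq (pairmap c x p) & all S (pairmap c x p)].

Lemma rainbow_walk0 c A S x : rainbow_walk c A S x x.
Proof. by exists [::]. Qed.

Lemma rainbow_walkW c A S T x y :
  {subset S <= T} -> rainbow_walk c A S x y -> rainbow_walk c A T x y.
Proof.
move=> ST [p [pth lst un al]]; exists p; split=> //.
by apply: sub_all al => k; exact: ST.
Qed.

Lemma rainbow_walk_cat c A S T x y z :
  (forall k, S k -> T k -> False) ->
  rainbow_walk c A S x y -> rainbow_walk c A T y z ->
  rainbow_walk c A [pred k | S k || T k] x z.
Proof.
move=> dis [p [pth lst un al]] [q [qth <- un' al']]; subst y.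
exists (p ++ q); rewrite cat_path last_cat pth qth pairmap_cat cat_uniq all_cat.
split=> //.
  rewrite un un' andbT; apply/hasPn => k /(allP al') Tk.
  by apply/negP => /(allP al) Sk; exact: dis Sk Tk.
by apply/andP; split; [apply: sub_all al | apply: sub_all al'] => k /= ->;
  rewrite ?orbT.
Qed.

Lemma pairmap_rev_rcons c x p z : commutative c ->
  pairmap c z (rev (x :: p)) =
  c z (last x p) :: rev (pairmap c x p).
Proof.
move=> cs; elim: p x => [|y p IH] x //.
rewrite rev_cons -cats1 pairmap_cat IH /= (rev_cons y) last_rcons cs.
by rewrite rev_cons cats1 (cs x).
Qed.

Lemma rainbow_walk_sym c A S x y : commutative c ->
  rainbow_walk c A S x y -> rainbow_walk c A S y x.
Proof.
move=> cs [p [pth <- un al]].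
have E : pairmap c (last x p) (rev (belast x p)) = rev (pairmap c x p).
  case: p {pth un al} => [|u p] //.
  have := @pairmap_rev_rcons c x (u :: p) (last x (u :: p)) cs.
  by rewrite (lastI x (u :: p)) rev_rcons [pairmap c _ (_ :: rev _)]/= => -[].
exists (rev (belast x p)); rewrite E rev_uniq all_rev; split=> //.
  rewrite rev_path; apply: sub_path pth => u v; by rewrite adj_in_sym.
by case: p {pth un al E} => // u p; rewrite /= rev_cons last_rcons.
Qed.

Definition rainbow_conn c A k :=
  {in A &, forall x y, rainbow_walk c A (gtn k) x y}.

Definition missing c A k x y :=
  exists2 z, z < k & rainbow_walk c A [pred i | (i < k) && (i != z)] x y.

Lemma missing_sym c A k x y : commutative c ->
  missing c A k x y -> missing c A k y x.
Proof. by move=> cs [z zk w]; exists z => //; exact: rainbow_walk_sym. Qed.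

Lemma missing0 c A k x : 0 < k -> missing c A k x x.
Proof. by move=> k0; exists 0 => //; exact: rainbow_walk0. Qed.

End Walks.

Section EarColouring.
Variable G : sgraph.
Implicit Types (A B : {set G}) (c : G -> G -> nat) (S T : pred nat).
Implicit Types (x y z u v : G) (p q : seq G).

Definition ear A a b p : Prop :=
  [/\ a \in A, b \in A, a != b, p != [::] &
      [/\ uniq p, {in p, forall u, u \notin A} & path (@adj G) a (rcons p b)]].

Definition add_ear A p : {set G} := A :|: [set u in p].

(* The edge of [s] ending at its [i]-th vertex gets the colour [f i]. *)
Definition extend c A (s : seq G) (f : nat -> nat) : G -> G -> nat :=
  fun u v => if (u \in A) && (v \in A) then c u v
             else f (maxn (index u s) (index v s)).

Lemma extend_sym c A s f : commutative c -> commutative (extend c A s f).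
Proof. by move=> cs u v; rewrite /extend andbC cs maxnC. Qed.

Lemma extend_walk c A B s f S x y : A \subset B ->
  rainbow_walk c A S x y -> rainbow_walk (extend c A s f) B S x y.
Proof.
move=> AB [p [pth lst un al]]; exists p.
have E : pairmap (extend c A s f) x p = pairmap c x p.
  elim: p x pth {lst un al} => //= u p IH x /andP[/and3P[xA uA _] /IH ->].
  by rewrite /extend xA uA.
rewrite E; split=> //; apply: sub_path pth => u v; exact: adj_inS.
Qed.

Lemma extend_missing c A B s f k x y : A \subset B ->
  missing c A k x y -> missing (extend c A s f) B k x y.
Proof. by move=> AB [z zk w]; exists z => //; exact: extend_walk. Qed.

Lemma card_add_ear A a b p : ear A a b p -> #|add_ear A p| = #|A| + size p.
Proof.
case=> _ _ _ _ [un out _]; rewrite cardsU.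
rewrite (_ : A :&: _ = set0) ?cards0 ?subn0; last first.
  by apply/setP=> u; rewrite !inE; apply/negP=> /andP[uA /out]; rewrite uA.
by rewrite cardsE (card_uniqP un).
Qed.

Lemma ear_rev A a b p : ear A a b p -> ear A b a (rev p).
Proof.
case=> aA bA ab p0 [un out pth]; split=> //.
- by rewrite eq_sym.
- by rewrite -size_eq0 size_rev size_eq0.
split; rewrite ?rev_uniq //; first by move=> u; rewrite mem_rev; exact: out.
have := rev_path (@adj G) a (rcons p b).
rewrite last_rcons belast_rcons rev_cons => ->.
by rewrite (eq_path (e' := @adj G)) // => u v; rewrite adj_sym.
Qed.

Lemma add_ear_rev A p : add_ear A (rev p) = add_ear A p.
Proof. by apply/setP=> u; rewrite !inE mem_rev. Qed.

Lemma add_ear_sub A B p :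
  B \subset A -> {subset p <= A} -> add_ear B p \subset A.
Proof.
by move=> BA pA; apply/subsetP=> v; rewrite in_setU inE => /orP[/(subsetP BA)|/pA].
Qed.

Section Ear.
Variables (A : {set G}) (a b : G) (p : seq G).
Hypothesis earP : ear A a b p.
Variables (c : G -> G -> nat) (f : nat -> nat).

Let s := a :: rcons p b.
Let V i := nth a s i.
Let c' := extend c A s f.
Let A' := add_ear A p.

Lemma ear_uniq : uniq s.
Proof.
case: earP => aA bA ab p0 [un out pth].
rewrite /s /= mem_rcons inE (negbTE ab) rcons_uniq un !andbT /=.
by apply/andP; split; apply/negP => /out; rewrite ?aA ?bA.
Qed.

Lemma ear_vertex i : 0 < i < (size p).+1 -> V i \notin A.
Proof.
case: earP => aA bA ab p0 [un out pth] ip.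
apply: out; rewrite /V /s; case: i ip => //= i ip.
by rewrite nth_rcons; case: ltnP => [*|]; rewrite ?mem_nth //; nat_lia.
Qed.

Lemma ear_vertexP u : u \in A' ->
  u \in A \/ exists2 i, 0 < i < (size p).+1 & u = V i.
Proof.
rewrite !inE => /orP[|up]; [by left | right].
exists (index u p).+1; first by rewrite /= ltnS index_mem.
by rewrite /V /s /= nth_rcons index_mem up nth_index.
Qed.

Lemma ear_walk S i j : i <= j <= (size p).+1 ->
  (forall k k', i < k -> k < k' -> k' <= j -> f k <> f k') ->
  (forall k, i < k <= j -> S (f k)) ->
  rainbow_walk c' A' S (V i) (V j).
Proof.
case: earP => aA bA ab p0 [un out pth].
case/andP; elim: j S => [|j IH] S ij jp inj Sf.
  by rewrite leqn0 in ij; rewrite (eqP ij); exact: rainbow_walk0.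
case: (ltngtP i j.+1) ij => // [ij _|-> _]; last exact: rainbow_walk0.
(* The induction hypothesis is used with the exact set of colours met so far in place of [S], so
   that the colour of the last edge is seen to be new. *)
have w : rainbow_walk c' A' [pred k | k \in [seq f n | n <- iota i.+1 (j - i)]]
           (V i) (V j).
  apply: IH; [exact: ij | nat_lia | by move=> k k' *; apply: inj; lia |].
  by move=> k kj /=; apply: map_f; rewrite mem_iota; nat_lia.
have inA' k : k <= (size p).+1 -> V k \in A'.
  move=> kp; have : V k \in s by rewrite mem_nth //= size_rcons.
  by rewrite /s inE mem_rcons !inE => /or3P[/eqP->|/eqP->|->]; rewrite ?aA ?bA ?orbT.
have adjV : adj (V j) (V j.+1).
  by have /(pathP a)/(_ j) := pth; rewrite size_rcons; apply; nat_lia.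
(* [extend] uses the ear colour only if the two ends are not both in [A]. As [p] is nonempty, this
   also holds for the first and the last edge. *)
have out' : ~~ ((V j \in A) && (V j.+1 \in A)).
  case: (posnP j) => [j0|j0].
    case: (ltnP j.+1 (size p).+1) => jp'.
      have /negbTE -> : V j.+1 \notin A by apply: ear_vertex; nat_lia.
      by rewrite andbF.
    by case: (p) p0 jp' => //= ? ?; nat_lia.
  by have /negbTE -> : V j \notin A by apply: ear_vertex; nat_lia.
have w1 : rainbow_walk c' A' (pred1 (f j.+1)) (V j) (V j.+1).
  exists [:: V j.+1]; split=> //=.
    by rewrite andbT; apply/and3P; split=> //; apply: inA'; nat_lia.
  rewrite /c' /extend (negbTE out') !index_uniq ?ear_uniq /s /= ?size_rcons //; try nat_lia.
  by rewrite (_ : maxn j j.+1 = j.+1) ?eqxx //; nat_lia.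
apply: rainbow_walkW (rainbow_walk_cat _ w w1).
  move=> k; rewrite !inE => /orP[/mapP[n]|/eqP ->].
    by rewrite mem_iota => nij ->; apply: Sf; nat_lia.
  by apply: Sf; nat_lia.
move=> k /= /mapP[n]; rewrite mem_iota => nij -> /eqP.
by apply: inj; nat_lia.
Qed.

Lemma ear_last : V (size p).+1 = b.
Proof. by rewrite /V /s /= nth_rcons ltnn eqxx. Qed.

End Ear.
End EarColouring.

(** * Colourings of an ear *)

(* The colours along an ear with [2 * l + d] inner vertices, [d <= 1], when the
   old colours are those below [k]: first [k, ..., k + l - 1], then [y], then
   [k + l] if [d = 1], then [k, ..., k + l - 1] again. *)
Definition ear_colour k l y d i :=
  if i <= l then k + i.-1 else if i == l.+1 then y
  else if i <= l.+1 + d then k + l else k + (i - (l + 2 + d)).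

Ltac ear_colour_lia := rewrite /= /ear_colour; repeat case: ifP; lia.

Section Pattern.
Variable G : sgraph.
Implicit Types (S T : pred nat) (u v x : G).
Variables (A : {set G}) (a b : G) (p : seq G).
Hypothesis earP : ear A a b p.
Variable c : G -> G -> nat.
Hypothesis cC : commutative c.
Variables (k l y d : nat).
Hypotheses (d1 : d <= 1) (sz : size p = l + l + d) (yk : y < k).

Let V i := nth a (a :: rcons p b) i.
Let c' := extend c A (a :: rcons p b) (ear_colour k l y d).
Let A' := add_ear A p.

Let aA : a \in A. Proof. by case: earP. Qed.
Let bA : b \in A. Proof. by case: earP. Qed.
Let sAA' : A \subset A'. Proof. exact: subsetUl. Qed.
Let c'C : commutative c'. Proof. exact: extend_sym. Qed.

Let old S u v : rainbow_walk c A S u v -> rainbow_walk c' A' S u v.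
Proof. exact: extend_walk. Qed.

Lemma pattern_left i : i <= l ->
  rainbow_walk c' A' [pred n | k <= n < k + i] a (V i).
Proof.
move=> il; rewrite -[a]/(V 0); apply: (ear_walk earP); first lia.
  by move=> n n' *; ear_colour_lia.
by move=> n *; ear_colour_lia.
Qed.

Lemma pattern_right i : l.+1 + d <= i <= (size p).+1 ->
  rainbow_walk c' A' [pred n | k + (i - (l.+1 + d)) <= n < k + l] (V i) b.
Proof.
move=> il; rewrite -(ear_last a b p); apply: (ear_walk earP); first lia.
  by move=> n n' *; ear_colour_lia.
by move=> n *; ear_colour_lia.
Qed.

Lemma pattern_middle : 
  rainbow_walk c' A' [pred n | k <= n < k + l + d] (V l.+1) b.
Proof.
move=> *; rewrite -(ear_last a b p); apply: (ear_walk earP); first lia.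
  by move=> n n' *; ear_colour_lia.
by move=> n *; ear_colour_lia.
Qed.

Lemma via_left S u i : i <= l -> rainbow_walk c A S u a ->
  (forall n, S n -> k <= n < k + i -> False) ->
  rainbow_walk c' A' [pred n | S n || (k <= n < k + i)] u (V i).
Proof.
by move=> il w dis; apply: rainbow_walk_cat dis (old w) (pattern_left il).
Qed.

Lemma via_right S u i : l.+1 + d <= i <= (size p).+1 -> rainbow_walk c A S u b ->
  (forall n, S n -> k + (i - (l.+1 + d)) <= n < k + l -> False) ->
  rainbow_walk c' A' [pred n | S n || (k + (i - (l.+1 + d)) <= n < k + l)] u (V i).
Proof.
move=> il w dis; apply: rainbow_walk_cat dis (old w) _.
exact: rainbow_walk_sym (pattern_right il).
Qed.

Section Conn.
Hypothesis rc : rainbow_conn c A k.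

(** Between the two halves, either the segment of the ear or the way round through [a], [A] and [b]
    is rainbow. With [m = j - (l.+1 + d)], the segment repeats no colour as soon as [m <= i], and
    the way round ([pattern_round]) none as soon as [i <= m]. *)
Lemma pattern_direct i j : i <= l -> l.+1 + d <= j <= (size p).+1 ->
  j <= l.+1 + d + i ->
  rainbow_walk c' A'
    [pred n | [|| n == y, k + i <= n < k + l + d | k <= n < k + (j - (l.+1 + d))]]
    (V i) (V j).
Proof.
move=> il jl ij; apply: (ear_walk earP); first lia.
  by move=> n n' *; ear_colour_lia.
by move=> n *; ear_colour_lia.
Qed.

Lemma pattern_round i j : i <= l -> l.+1 + d <= j <= (size p).+1 ->
  l.+1 + d + i <= j ->
  rainbow_walk c' A'
    [pred n | [|| n < k, n < k + i | k + (j - (l.+1 + d)) <= n < k + l]]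
    (V i) (V j).
Proof.
move=> il jl ij.

have := rainbow_walk_cat _ (rainbow_walk_sym c'C (pattern_left il))
  (via_right jl (rc aA bA) _).
move=> W; apply: rainbow_walkW (W _ _).
- by move=> n; rewrite !inE; lia.
- by move=> n /=; lia.
- by move=> n /=; lia.
Qed.

Lemma pattern_conn : rainbow_conn c' A' (k + l + d).
Proof.
have uV u i : u \in A -> 0 < i < (size p).+1 ->
    rainbow_walk c' A' (gtn (k + l + d)) u (V i).
  move=> uA ip; case: (leqP i l) => il.
    apply: rainbow_walkW (via_left il (rc uA aA) _); move=> n; rewrite ?inE /=; lia.
  case: (leqP (l.+1 + d) i) => id.
    apply: rainbow_walkW (via_right _ (rc uA bA) _).
    - by move=> n; rewrite !inE /=; lia.
    - lia.
    - by move=> n /=; lia.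
  have -> : i = l.+1 by lia.
  apply: rainbow_walkW (rainbow_walk_cat _ (old (rc uA bA))
    (rainbow_walk_sym c'C pattern_middle)) => n; rewrite ?inE /=; lia.
have VV i j : 0 < i -> i <= j -> j < (size p).+1 ->
    rainbow_walk c' A' (gtn (k + l + d)) (V i) (V j).
  move=> i0 ij jp.
  case: (boolP ((i <= l) && (l.+1 + d <= j))) => [/andP[il jl]|H].
    case: (leqP j (l.+1 + d + i)) => ji.
      apply: rainbow_walkW (pattern_direct il _ ji); last lia.
      by move=> n; rewrite !inE /=; lia.
    apply: rainbow_walkW (pattern_round il _ _); try lia.
    by move=> n; rewrite !inE /=; lia.
  apply: (ear_walk earP); first lia.
    by move=> n n' *; ear_colour_lia.
  by move=> n *; ear_colour_lia.
move=> u v /(ear_vertexP a b)[uA|[i ip ->]] /(ear_vertexP a b)[vA|[j jp ->]].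
- apply: rainbow_walkW (old (rc uA vA)) => n; rewrite !inE /=; lia.
- exact: (uV u j).
- by apply: rainbow_walk_sym => //; exact: (uV v i).
- case: (leqP i j) => ij; first by apply: VV; lia.
  by apply: rainbow_walk_sym => //; apply: VV; lia.
Qed.

Lemma miss_old u v : 0 < l + d -> u \in A -> v \in A ->
  missing c' A' (k + l + d) u v.
Proof.
move=> ld uA vA; exists k; first lia.
by apply: rainbow_walkW (old (rc uA vA)) => n; rewrite !inE /=; lia.
Qed.

(** The left half is reached through [a], where the last new colour is not yet used. The right half
    ([miss_right]) is reached through [b], skipping [k], or [k + l] if [d = 1]. This leaves out
    [V l] and [V l.+1] if [d = 0], and only [V l.+1] if [d = 1]. *)
Lemma miss_left u i : i < l + d -> i <= l -> u \in A ->
  missing c' A' (k + l + d) u (V i).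
Proof.
move=> il il' uA; exists (k + l + d).-1; first lia.
by apply: rainbow_walkW (via_left il' (rc uA aA) _) => n; rewrite ?inE /=; lia.
Qed.

Lemma miss_right u i : l.+1 + d <= i <= (size p).+1 -> 0 < d \/ l.+1 + d < i ->
  u \in A -> missing c' A' (k + l + d) u (V i).
Proof.
move=> il di uA; exists (if d == 0 then k else k + l); first by case: ifP; lia.
by apply: rainbow_walkW (via_right il (rc uA bA) _) => n; rewrite ?inE /=;
  try case: ifP; lia.
Qed.


(** A colour missed on the way to [a] stays missed, since the left half of the ear adds new colours
    only. For [d = 0] this serves the vertex [V l], and [miss_via_right] serves [V l.+1]. *)
Lemma miss_via_left u i : i <= l -> missing c A k u a ->
  missing c' A' (k + l + d) u (V i).
Proof.
move=> il [z zk w]; exists z; first lia.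
by apply: rainbow_walkW (via_left il w _) => n; rewrite ?inE /=; lia.
Qed.

Lemma miss_via_right u i : l.+1 + d <= i <= (size p).+1 -> missing c A k u b ->
  missing c' A' (k + l + d) u (V i).
Proof.
move=> il [z zk w]; exists z; first lia.
by apply: rainbow_walkW (via_right il w _) => n; rewrite ?inE /=; lia.
Qed.

(** Towards the left, the segment of the ear avoids [y]. Towards the right, it stops before the last
    edge of the ear, the only edge of that half with the last new colour. *)
Lemma miss_inner_left i : d = 0 -> 0 < i < (size p).+1 ->
  missing c' A' (k + l + d) (V l) (V i).
Proof.
move=> d0 ip; case: (leqP i l) => il.
  apply: missing_sym => //; exists y; first lia.
  apply: (ear_walk earP); first lia.
    by move=> n n' *; ear_colour_lia.
  by move=> n *; ear_colour_lia.
exists (k + l).-1; first lia.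
apply: (ear_walk earP); first lia.
  by move=> n n' *; ear_colour_lia.
by move=> n *; ear_colour_lia.
Qed.

Lemma miss_inner_right i : d = 0 -> 0 < i < (size p).+1 ->
  missing c' A' (k + l + d) (V l.+1) (V i).
Proof.
move=> d0 ip; case: (leqP i l) => il.
  apply: missing_sym => //; exists k; first lia.
  apply: (ear_walk earP); first lia.
    by move=> n n' *; ear_colour_lia.
  by move=> n *; ear_colour_lia.
exists y; first lia.
apply: (ear_walk earP); first lia.
  by move=> n n' *; ear_colour_lia.
by move=> n *; ear_colour_lia.
Qed.

(** If the segment of the ear ends early enough in the right half, it misses the colour [(k + i).-1]
    of the edge before [V i]. Otherwise the way round, or a segment inside one half, misses the
    middle colour [k + l]. *)
Lemma miss_inner i j : d = 1 -> 0 < i -> i <= j -> j < (size p).+1 ->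
  i != l.+1 -> j != l.+1 -> missing c' A' (k + l + d) (V i) (V j).
Proof.
move=> dE i0 ij jp il jl.
case: (boolP ((i <= l) && (l.+1 + d <= j <= l.+1 + d + i.-1))) => H.
  exists (k + i).-1; first lia.
  apply: rainbow_walkW (pattern_direct (i := i) (j := j) _ _ _); try lia.
  by move=> n; rewrite !inE /=; lia.
exists (k + l); first lia.
case: (boolP ((i <= l) && (l.+1 + d <= j))) => H'.
  apply: rainbow_walkW (pattern_round (i := i) (j := j) _ _ _); try lia.
  by move=> n; rewrite !inE /=; lia.
apply: (ear_walk earP); first lia.
  by move=> n n' *; ear_colour_lia.
by move=> n *; ear_colour_lia.
Qed.

End Conn.

(** On the ear, [k + l] occurs only on the edge just after the middle vertex [V l.+1], so the halves
    are reached from [a] and [b] without it. The middle vertex is reached from [a] through the edge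
    coloured [y], which is why [y] has to be missed between [q] and [a]. *)
Lemma pattern_avoid_new q : d = 1 ->
  (forall u, u \in A -> rainbow_walk c A (gtn k) q u) ->
  rainbow_walk c A [pred n | (n < k) && (n != y)] q a ->
  forall u, u \in A' ->
    rainbow_walk c' A' [pred n | (n < k + l + d) && (n != k + l)] q u.
Proof.
move=> dE qA qa u /(ear_vertexP a b)[uA|[i ip ->]].
  by apply: rainbow_walkW (old (qA _ uA)) => n; rewrite !inE /=; lia.
case: (leqP i l) => il.
  by apply: rainbow_walkW (via_left il (qA _ aA) _) => n; rewrite ?inE /=; lia.
case: (leqP (l.+1 + d) i) => id.
  have id' : l.+1 + d <= i <= (size p).+1 by lia.
  by apply: rainbow_walkW (via_right id' (qA _ bA) _) => n; rewrite ?inE /=; lia.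
have -> : i = l.+1 by lia.
have w : rainbow_walk c' A' [pred n | (n == y) || (k <= n < k + l)] a (V l.+1).
  rewrite -[a]/(V 0); apply: (ear_walk earP); first lia.
    by move=> n n' *; ear_colour_lia.
  by move=> n *; ear_colour_lia.
by apply: rainbow_walkW (rainbow_walk_cat _ (old qa) w) => n; rewrite ?inE /=; lia.
Qed.

(** Every inner vertex lies in one of the two halves, which add new colours only; the edge coloured
    [y] is never crossed. *)
Lemma pattern_avoid_old q (x : nat) : d = 0 -> x < k ->
  (forall u, u \in A -> rainbow_walk c A [pred n | (n < k) && (n != x)] q u) ->
  forall u, u \in A' ->
    rainbow_walk c' A' [pred n | (n < k + l + d) && (n != x)] q u.
Proof.
move=> d0 xk qA u /(ear_vertexP a b)[uA|[i ip ->]].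
  by apply: rainbow_walkW (old (qA _ uA)) => n; rewrite !inE /=; lia.
case: (leqP i l) => il.
  by apply: rainbow_walkW (via_left il (qA _ aA) _) => n; rewrite ?inE /=; lia.
have id' : l.+1 + d <= i <= (size p).+1 by lia.
by apply: rainbow_walkW (via_right id' (qA _ bA) _) => n; rewrite ?inE /=; lia.
Qed.

End Pattern.

(** * Passing the claims on to a set with one more ear *)

Section Claims.
Variable G : sgraph.
Implicit Types (A : {set G}) (c : G -> G -> nat) (p : seq G).

Definition avoiding c A k q :=
  exists2 x, x < k &
  forall u, u \in A -> rainbow_walk c A [pred n | (n < k) && (n != x)] q u.

Definition even_claim A r s t := exists c,
  [/\ commutative c, rainbow_conn c A (uphalf #|A|) &
      missing c A (uphalf #|A|) r s \/ missing c A (uphalf #|A|) r t].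

Definition odd_claim A q r s t := exists c,
  [/\ commutative c, rainbow_conn c A (uphalf #|A|),
      avoiding c A (uphalf #|A|) q &
      missing c A (uphalf #|A|) r s \/ missing c A (uphalf #|A|) r t].

Definition even_colourable A := forall r s t,
  r \in A -> s \in A -> t \in A -> s != t -> even_claim A r s t.

Definition odd_colourable A := forall q r s t, q \in A ->
  r \in A -> s \in A -> t \in A -> s != t -> odd_claim A q r s t.

Lemma even_earE A a b p : ear A a b p -> ~~ odd (size p) ->
  exists l, [/\ size p = l + l + 0, 0 < l &
   uphalf #|add_ear A p| = uphalf #|A| + l + 0].
Proof.
move=> eP ev; exists (size p)./2; rewrite (card_add_ear eP).
case: eP => _ _ _ p0 _; have : 0 < size p by case: (p) p0.
by have := odd_double_half (size p); rewrite (negbTE ev) => E; split; nat_lia.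
Qed.

Lemma ear_card A a b p : ear A a b p -> 1 < #|A|.
Proof.
case=> aA bA ab _ _; rewrite (cardsD1 a) aA (cardsD1 b) !inE bA eq_sym ab; nat_lia.
Qed.

(** Seen from [r], only the two middle vertices of the ear can fail to miss a colour, and by the
    assumption on [a] and [b] one of these does miss one. As [s != t], either one of [s] and [t] is
    not a middle vertex, or they are both middle vertices. *)
Lemma miss_even_ear A a b p c l y r s t : ear A a b p -> commutative c ->
  rainbow_conn c A (uphalf #|A|) -> y < uphalf #|A| ->
  size p = l + l + 0 -> 0 < l ->
  r \in A -> s \in add_ear A p -> t \in add_ear A p -> s != t ->
  missing c A (uphalf #|A|) r a \/ missing c A (uphalf #|A|) r b ->
  let c' := extend c A (a :: rcons p b) (ear_colour (uphalf #|A|) l y 0) in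
  let k := uphalf #|A| + l + 0 in
  missing c' (add_ear A p) k r s \/ missing c' (add_ear A p) k r t.
Proof.
move=> eP cC rc yk sz l0 rA sA tA st rab c' k.
have ok u : u \in add_ear A p ->
  [\/ missing c' (add_ear A p) k r u, u = nth a (a :: rcons p b) l |
      u = nth a (a :: rcons p b) l.+1].
  case/(ear_vertexP a b) => [uA|[i ip ->]].
    by apply: Or31; apply: miss_old => //; nat_lia.
  case: (ltngtP i l) => il; last by rewrite il; apply: Or32.
    by apply: Or31; apply: miss_left => //; nat_lia.
  case: (ltngtP i l.+1) => il'; try nat_lia; last by rewrite il'; apply: Or33.
  by apply: Or31; apply: miss_right => //; nat_lia.
have mab : missing c' (add_ear A p) k r (nth a (a :: rcons p b) l) \/
           missing c' (add_ear A p) k r (nth a (a :: rcons p b) l.+1).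
  case: rab => m; [left | right]; first by apply: miss_via_left.
  by apply: miss_via_right => //; nat_lia.
case: (ok s sA) => [m|sE|sE]; first by left.
  case: (ok t tA) => [m|tE|tE]; first by right.
    by rewrite sE tE eqxx in st.
  by rewrite sE tE.
case: (ok t tA) => [m|tE|tE]; first by right.
  by rewrite sE tE or_comm.
by rewrite sE tE eqxx in st.
Qed.

Lemma even_even_ear A a b p r s t : ear A a b p -> ~~ odd (size p) ->
  even_claim A r a b -> r \in A -> s \in add_ear A p -> t \in add_ear A p ->
  s != t -> even_claim (add_ear A p) r s t.
Proof.
move=> eP ev [c [cC rc m]] rA sA tA st.
have [l [sz l0 E]] := even_earE eP ev; have A1 := ear_card eP.
(* Any old colour can be put on the middle edge; [0] is one of them. *)
exists (extend c A (a :: rcons p b) (ear_colour (uphalf #|A|) l 0 0)).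
rewrite /even_claim E; split; first exact: extend_sym.
  by apply: pattern_conn => //; nat_lia.
by apply: miss_even_ear => //; nat_lia.
Qed.

Lemma odd_even_ear A a b p q r s t : ear A a b p -> ~~ odd (size p) ->
  odd_claim A q r a b -> q \in A -> r \in A -> s \in add_ear A p ->
  t \in add_ear A p -> s != t -> odd_claim (add_ear A p) q r s t.
Proof.
move=> eP ev [c [cC rc [x xk av] m]] qA rA sA tA st.
have [l [sz l0 E]] := even_earE eP ev; have A1 := ear_card eP.
exists (extend c A (a :: rcons p b) (ear_colour (uphalf #|A|) l 0 0)).
rewrite /odd_claim E; split; first exact: extend_sym.
- by apply: pattern_conn => //; nat_lia.
- exists x; first nat_lia.
  by apply: pattern_avoid_old => //; nat_lia.
by apply: miss_even_ear => //; nat_lia.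
Qed.

(** Here [r] may lie inside the ear, at the price of [t \in A]. If [r] is not a middle vertex, then
    [r] and [t] miss a colour. If it is, old vertices are reached along its own half, so the claim
    for [A] is used with the end of that half in place of [r]; an inner vertex [s] is reached along
    the ear. *)
Lemma even_even_ear_inner A a b p r s t : ear A a b p -> ~~ odd (size p) ->
  even_colourable A -> r \in add_ear A p -> s \in add_ear A p -> t \in A ->
  s != t -> even_claim (add_ear A p) r s t.
Proof.
move=> eP ev IH rA sA tA st.
have tA' : t \in add_ear A p by rewrite inE tA.
have [aA bA ab _ _] := eP.
case: (boolP (r \in A)) => [rA'|rA'].
  by apply: (even_even_ear eP) => //; exact: IH.
have [l [sz l0 E]] := even_earE eP ev; have A1 := ear_card eP.
case: (ear_vertexP a b rA) => [rA''|[i ip rE]]; first by rewrite rA'' in rA'.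
have [c [cC rc m]] : exists c, [/\ commutative c, rainbow_conn c A (uphalf #|A|)
    & s \in A -> let v := if i == l then a else b in
    missing c A (uphalf #|A|) v s \/ missing c A (uphalf #|A|) v t].
  case: (boolP (s \in A)) => sA'.
    have [|c [cC rc m]] := IH (if i == l then a else b) s t _ sA' tA st.
      by case: ifP.
    by exists c; split.
  have [c [cC rc m]] := IH a a b aA aA bA ab.
  by exists c; split.
exists (extend c A (a :: rcons p b) (ear_colour (uphalf #|A|) l 0 0)).
have y0 : 0 < uphalf #|A| by nat_lia.
rewrite E.
have c'C := extend_sym A (a :: rcons p b) (ear_colour (uphalf #|A|) l 0 0) cC.
split => //; first by apply: pattern_conn => //; nat_lia.
rewrite rE; case: (boolP ((i == l) || (i == l.+1))) => il; last first.
  right; apply: missing_sym => //; case: (leqP i l) => il'.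
    by apply: miss_left => //; nat_lia.
  by apply: miss_right => //; nat_lia.
case: (ear_vertexP a b sA) => [sA'|[j jp ->]].
  case/orP: il m => /eqP -> /(_ sA').
    rewrite eqxx /= => -[] /(missing_sym cC) m; [left|right];
    by apply: missing_sym => //; apply: miss_via_left.
  rewrite ifF; last nat_lia.
  by move=> -[] /(missing_sym cC) m; [left|right];
    apply: missing_sym => //; apply: miss_via_right => //; nat_lia.
left; case/orP: il => /eqP ->; first exact: miss_inner_left.
exact: miss_inner_right.
Qed.

Lemma odd_earE A a b p : ear A a b p -> odd (size p) -> ~~ odd #|A| ->
  let l := (size p)./2 in
  size p = l + l + 1 /\ uphalf #|add_ear A p| = uphalf #|A| + l + 1.
Proof.
move=> eP od ev l; rewrite (card_add_ear eP) /l; have := odd_double_half (size p).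
by rewrite od; nat_lia.
Qed.

Lemma miss_odd_ear A a b p c l y r u : ear A a b p -> commutative c ->
  rainbow_conn c A (uphalf #|A|) -> y < uphalf #|A| ->
  size p = l + l + 1 ->
  r \in add_ear A p -> u \in add_ear A p ->
  r != nth a p l -> u != nth a p l ->
  missing (extend c A (a :: rcons p b) (ear_colour (uphalf #|A|) l y 1))
    (add_ear A p) (uphalf #|A| + l + 1) r u.
Proof.
move=> eP cC rc yk sz.
have c'C := extend_sym A (a :: rcons p b) (ear_colour (uphalf #|A|) l y 1) cC.
have El : nth a p l = nth a (a :: rcons p b) l.+1.
  by rewrite /= nth_rcons ifT //; nat_lia.
have AV u' i : u' \in A -> 0 < i < (size p).+1 -> i != l.+1 ->
    missing (extend c A (a :: rcons p b) (ear_colour (uphalf #|A|) l y 1))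
    (add_ear A p) (uphalf #|A| + l + 1) u' (nth a (a :: rcons p b) i).
  move=> uA ip il; case: (leqP i l) => il'.
    by apply: miss_left => //; nat_lia.
  by apply: miss_right => //; nat_lia.
rewrite El; case/(ear_vertexP a b) => [rA|[i ip ->]];
  case/(ear_vertexP a b) => [uA|[j jp ->]] ri uj.
- by apply: miss_old => //; nat_lia.
- by apply: AV => //; apply: contraNneq uj => ->.
- by apply: missing_sym => //; apply: AV => //; apply: contraNneq ri => ->.
have il : i != l.+1 by apply: contraNneq ri => ->.
have jl : j != l.+1 by apply: contraNneq uj => ->.
case: (leqP i j) => ij; first by apply: miss_inner => //; nat_lia.
by apply: missing_sym => //; apply: miss_inner => //; nat_lia.
Qed.

(** The old colour missed between [q] and [a] becomes [y], and the new middle colour becomes the one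
    avoidable from [q]. As [s != t], one of them is not the middle vertex, and together with [r] it
    misses a colour. *)
Lemma even_odd_ear_missing A a b p c q r s t : ear A a b p -> odd (size p) ->
  ~~ odd #|A| -> commutative c -> rainbow_conn c A (uphalf #|A|) ->
  missing c A (uphalf #|A|) q a ->
  q \in A -> r \in add_ear A p -> s \in add_ear A p -> t \in add_ear A p ->
  r != nth a p (size p)./2 -> s != t -> odd_claim (add_ear A p) q r s t.
Proof.
move=> eP od ev cC rc [y yk qa] qA rA sA tA rl st.
have /= [] := odd_earE eP od ev; set l := (size p)./2 => sz E.
exists (extend c A (a :: rcons p b) (ear_colour (uphalf #|A|) l y 1)).
rewrite E; split; first exact: extend_sym.
- exact: pattern_conn.
- exists (uphalf #|A| + l); first nat_lia.
  by apply: pattern_avoid_new => // u; exact: rc.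
case: (eqVneq s (nth a p l)) => sl; last by left; apply: miss_odd_ear.
by right; apply: miss_odd_ear => //; rewrite -sl eq_sym.
Qed.

Lemma even_odd_ear A a b p q r s t : ear A a b p -> odd (size p) ->
  ~~ odd #|A| -> even_claim A q a b ->
  q \in A -> r \in add_ear A p -> s \in add_ear A p -> t \in add_ear A p ->
  r != nth a p (size p)./2 -> s != t -> odd_claim (add_ear A p) q r s t.
Proof.
move=> eP od ev [c [cC rc [] m]] qA rA sA tA rl st.
  exact: (even_odd_ear_missing eP od ev cC rc m).
(* Now [b] takes the part of [a]. Reversing an ear with an odd number of inner vertices keeps its
   middle vertex. *)
rewrite -add_ear_rev; have eP' := ear_rev eP.
apply: (even_odd_ear_missing eP' _ _ cC rc m);
  rewrite ?add_ear_rev ?size_rev //.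
have := odd_double_half (size p); rewrite od => sz.
rewrite nth_rev; last nat_lia.
rewrite (_ : size p - _ = (size p)./2); last nat_lia.
by rewrite (set_nth_default a) //; nat_lia.
Qed.

(* The first edge of the ear gets the colour avoidable from [a], so that its end
   can be treated as an old vertex; the rest of the ear is then an even one. *)
Lemma odd_odd_ear A a b p r s t t' : ear A a b p -> odd (size p) -> odd #|A| ->
  odd_claim A a r s t' -> r \in A -> s \in A ->
  1 < size p \/ t' = t -> even_claim (add_ear A p) r s t.
Proof.
move=> eP od odA [c [cC rc [x xk av] m]] rA sA pt.
have [aA bA ab p0 [un out pth]] := eP.
case: p => [|v p] // in eP od p0 un out pth pt *.
(* For a constant colour function the vertex list is immaterial: all edges from [v] to [A] get the
   colour [x]. *)
set A1 := add_ear A [:: v]; pose c1 := extend c A [::] (fun=> x).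
have vA : v \notin A by apply: out; rewrite inE eqxx.
have AA1 : A \subset A1 by exact: subsetUl.
have c1C : commutative c1 by exact: extend_sym.
have cA1 : uphalf #|A1| = uphalf #|A|.
  by rewrite /A1 /add_ear set_cons set_nil setU0 setUC cardsU1 vA; nat_lia.
have vA1 : v \in A1 by rewrite !inE eqxx orbT.
have av1 : rainbow_walk c1 A1 (pred1 x) a v.
  exists [:: v]; split=> //=; last by rewrite /c1 /extend (negbTE vA) andbF eqxx.
  by move: pth; rewrite /= /adj_in /= vA1 (subsetP AA1 _ aA) andbT => /andP[].
have rv u : u \in A -> rainbow_walk c1 A1 (gtn (uphalf #|A|)) v u.
  move=> uA; have w := extend_walk [::] (fun=> x) AA1 (av u uA).
  apply: rainbow_walkW (rainbow_walk_cat _ (rainbow_walk_sym c1C av1) w) => n;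
  rewrite ?inE /=; nat_lia.
have rc1 : rainbow_conn c1 A1 (uphalf #|A1|).
  rewrite cA1 => u w; rewrite !inE => /orP[uA|/eqP->] /orP[wA|/eqP->].
  - exact: extend_walk (rc _ _ uA wA).
  - by apply: rainbow_walk_sym => //; exact: rv.
  - exact: rv.
  - exact: rainbow_walk0.
(* If [v] is the whole ear, the missing colour is inherited from [A], whence the condition [t' = t].
   Otherwise the rest of the ear brings new colours, which [r] and [s] miss. *)
case: p => [|v2 p] // in eP od p0 un out pth pt *.
  exists c1; rewrite cA1; split=> //; first by rewrite -cA1.
  case: pt => // <-.
  by case: m => m; [left|right]; exact: extend_missing.
have eP1 : ear A1 v b (v2 :: p).
  have vb : v != b by apply: contraNneq vA => ->.
  move: un pth; rewrite [uniq _]/= => /andP[vp un] /andP[_ pth].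
  split=> //; first by rewrite !inE bA.
  split=> // u up; rewrite !inE negb_or; apply/andP; split.
    by apply: out; rewrite inE up orbT.
  by apply: contraNneq vp => <-.
have -> : add_ear A [:: v, v2 & p] = add_ear A1 (v2 :: p).
  by apply/setP=> u; rewrite !inE !orbA.
have [l [sz l0 E]] := even_earE eP1 od.
exists (extend c1 A1 (v :: rcons (v2 :: p) b) (ear_colour (uphalf #|A1|) l x 0)).
rewrite E; split; first exact: extend_sym.
  by apply: pattern_conn => //; nat_lia.
by left; apply: miss_old => //; [nat_lia|nat_lia|exact: (subsetP AA1)|exact: (subsetP AA1)].
Qed.

End Claims.

(** * Ear decompositions *)

Section TwoConnected.
Variable G : sgraph.
Implicit Types (A B X D : {set G}) (u v w x y z a b t : G) (p q : seq G).

(** The bound [1 < #|A|] admits a single edge, from which the ear decompositions start. *)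
Definition two_connected A :=
  1 < #|A| /\ forall X, #|X| < 2 -> connected_in (A :\: X).

Lemma two_connected_connected A : two_connected A -> connected_in A.
Proof. by case=> _ /(_ set0); rewrite cards0 setD0; apply. Qed.

Lemma two_connected_del A x : two_connected A -> connected_in (A :\ x).
Proof. by case=> _ /(_ [set x]); rewrite cards1; apply. Qed.

Lemma connect_adj_sym A : connect_sym (adj_in A).
Proof. by apply: sym_connect_sym; exact: adj_in_sym. Qed.

Lemma path_connect D a p v : a \in D -> {subset p <= D} ->
  path (@adj G) a p -> v \in p -> connect (adj_in D) a v.
Proof.
elim: p a => //= w p IH a aD pD /andP[aw pth]; rewrite inE.
have wD : w \in D by apply: pD; rewrite inE eqxx.
have aw' : connect (adj_in D) a w by apply: connect1; rewrite /adj_in /= aD wD.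
case/orP=> [/eqP->//|vp]; apply: connect_trans aw' _; apply: IH => // u up.
by apply: pD; rewrite inE up orbT.
Qed.

Lemma connected_extend C D : connected_in C -> C \subset D ->
  (forall v, v \in D -> exists2 u, u \in C & connect (adj_in D) u v) ->
  connected_in D.
Proof.
move=> conC CD h x y /h[u uC ux] /h[v vC vy].
apply: connect_trans (connect_trans _ vy); first by rewrite connect_adj_sym; exact: ux.
apply: connect_sub (conC u v uC vC) => {ux vy}u' v' /= uv.
by apply: connect1; exact: adj_inS CD _.
Qed.

Lemma two_connected_edge a b : adj a b -> two_connected [set a; b].
Proof.
move=> ab; split.
  by rewrite cards2; case: eqVneq ab => // ->; rewrite adj_irrefl.
move=> X X2 x y; rewrite !inE => /andP[xX xab] /andP[yX yab].
case: (eqVneq x y) => [->|xy]; first exact: connect0.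
apply: connect1; rewrite /= !inE xX yX xab yab /=.
case/orP: xab xy => /eqP->; case/orP: yab => /eqP->; rewrite ?eqxx //.
by rewrite adj_sym.
Qed.

(** After the deletion of at most one vertex, a remaining vertex of the ear still reaches [A] along
    the ear: towards [b] if the deleted vertex comes before it, [a] included, and towards [a]
    otherwise. *)
Lemma two_connected_ear A a b p :
  two_connected A -> ear A a b p -> two_connected (add_ear A p).
Proof.
move=> [A1 conA] eP; split.
  by apply: leq_trans A1 _; apply: subset_leq_card; exact: subsetUl.
move=> X X2; apply: (connected_extend (conA X X2)).
  by apply: setSD; exact: subsetUl.
have [aA bA ab p0 [un out pth]] := eP.
move=> v; rewrite inE => /andP[vX]; rewrite in_setU => /orP[vA|].
  by exists v; [rewrite inE vX | exact: connect0].
rewrite inE => vp; case/splitPr: vp un out pth {p0 eP} => p1 p2 un out pth.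
have X1 u w : u \in X -> w \in X -> u = w.
  by move=> uX wX; move: X2; rewrite ltnS => /card_le1_eqP h; exact: h.
case: (boolP (has (mem X) (a :: p1))) => [/hasP[x xp xX]|].
  have un' : uniq ((a :: p1) ++ v :: rcons p2 b).
    by have := ear_uniq (And5 aA bA ab _ (And3 un out pth)); rewrite /= rcons_cat; apply; case: (p1).
  have noX u : u \in v :: rcons p2 b -> u \notin X.
    move=> up; apply/negP=> uX; move: un'; rewrite cat_uniq => /and3P[_ /hasPn/(_ u up)].
    by rewrite (X1 u x uX xX) xp.
  exists b; first by rewrite inE bA noX // inE mem_rcons inE eqxx orbT.
  have bl : path (@adj G) b (rcons (rev p2) v).
    move: pth; rewrite rcons_cat cat_path /= => /and3P[_ _ pth].
    have := rev_path (@adj G) v (rcons p2 b).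
    rewrite last_rcons belast_rcons rev_cons => ->.
    by rewrite (eq_path (e' := @adj G)) // => u w; rewrite adj_sym.
  apply: (path_connect _ _ bl).
  - by rewrite !inE bA noX // inE mem_rcons inE eqxx orbT.
  - move=> u; rewrite mem_rcons inE mem_rev => up.
    rewrite !inE mem_cat inE up !orbT andbT noX // inE mem_rcons inE.
    by case/orP: up => ->; rewrite ?orbT.
  - by rewrite mem_rcons inE eqxx.
rewrite -all_predC => /allP noX.
exists a; first by rewrite inE aA andbT; apply: noX; rewrite inE eqxx.
have pth' : path (@adj G) a (rcons p1 v).
  by move: pth; rewrite rcons_cat cat_path (rcons_path _ _ p1) /= => /and3P[-> ->].
apply: (path_connect _ _ pth').
- by rewrite !inE aA andbT; apply: noX; rewrite inE eqxx.
- move=> u; rewrite mem_rcons inE => /orP[/eqP->|up].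
    by rewrite !inE vX mem_cat inE eqxx !orbT.
  rewrite !inE mem_cat up !orbT andbT; apply: noX; by rewrite inE up orbT.
- by rewrite mem_rcons inE eqxx.
Qed.

Lemma path_to_set A X u w : connected_in A -> u \in A -> u \notin X ->
  w \in A -> w \in X ->
  exists z q, [/\ z \in X, z \in A, path (@adj G) u (rcons q z), uniq (u :: q) &
                 {in u :: q, forall v, (v \in A) && (v \notin X)}].
Proof.
move=> conA uA uX wA wX; have /connectP[p0 pth0 E] := conA u w uA wA.
case/shortenP: pth0 E => p pth un _ E.
have hp : has (mem X) p.
  apply/hasP; exists w => //; case: p E {pth un} => [|v p ->] /=.
    by move=> wu; rewrite -wu wX in uX.
  exact: mem_last.
(* The path is cut at its first vertex in [X]. *)
case/split_find: hp pth un {E} => z q r zX nX.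
rewrite cat_path -cat_cons cat_uniq => /andP[pth _] /andP[un _].
have pthA : path (@adj G) u (rcons q z).
  by apply: sub_path pth => x y /and3P[].
have inA v : v \in rcons q z -> v \in A.
  move: pth; clear -uA; elim: (rcons q z) u uA => //= x s IH u _.
  case/andP=> /and3P[_ xA _] /IH h; rewrite inE => /orP[/eqP->//|].
  exact: h.
exists z, q; split=> //; first by apply: inA; rewrite mem_rcons inE eqxx.
  by move: un; rewrite -rcons_cons rcons_uniq => /andP[].
move=> v; rewrite inE => /orP[/eqP->|vq]; first by rewrite uA.
rewrite inA ?mem_rcons ?inE ?vq ?orbT //=.
by move/hasPn: nX; apply.
Qed.

(** The new ear follows the old one from [a] to [w] and then the detour to [z]. From a vertex [z] of
    [p2] it continues along the old ear; at a vertex [z] of [B] it ends, and [z != a] keeps its ends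
    distinct. *)
Lemma ear_detour B a b p1 w p2 u q z : ear B a b (p1 ++ w :: p2) ->
  path (@adj G) w (u :: rcons q z) -> uniq (u :: q) ->
  {in u :: q, forall v, (v \notin B) && (v \notin p1 ++ w :: p2)} ->
  z \in p2 \/ z \in B /\ z != a ->
  exists a' b' p', [/\ ear B a' b' p', u \in p' &
    {subset p' <= (p1 ++ w :: p2) ++ u :: q}].
Proof.
move=> [aB bB ab _ [un out pth]] pthu unu outu zP.
move: pth; rewrite rcons_cat cat_path => /andP[pth1 pth2].
have nB v : v \in u :: q -> v \notin B by move=> /outu/andP[].
have unp : uniq ((rcons p1 w) ++ u :: q).
  rewrite cat_uniq unu andbT; apply/andP; split.
    by move: un; rewrite -cat_rcons cat_uniq => /andP[].
  apply/hasPn => v /outu/andP[_]; rewrite -cat_rcons mem_cat negb_or => /andP[].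
  by [].
case: zP => [zp|[zB za]].
  case/splitPr: zp un out pth2 outu => p3 p4 un out pth2 outu.
  exists a, b, (rcons p1 w ++ (u :: q) ++ z :: p4); split.
  - split=> //; first by case: (p1).
    split.
    + rewrite catA cat_uniq unp andTb.
      move: un; rewrite -cat_rcons cat_uniq => /and3P[_ d1].
      rewrite cat_uniq => /and3P[_ _ ->]; rewrite andbT.
      apply/hasPn => v vz; rewrite mem_cat negb_or; apply/andP; split.
        by move/hasPn: d1; apply; rewrite mem_cat vz orbT.
      apply/negP => /outu/andP[_]; rewrite mem_cat inE mem_cat vz !orbT //.
    + move=> v; rewrite !mem_cat => /or3P[vp|vu|vz]; last 1 first.
      * by apply: out; rewrite mem_cat inE mem_cat vz !orbT.
      * by apply: out; move: vp; rewrite mem_rcons mem_cat !inE => /orP[]->; rewrite ?orbT.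
      * exact: nB.
    + move: pth2; rewrite /= rcons_cat cat_path /= => /and3P[lw _ /andP[_ pz]].
      rewrite !rcons_cat !cat_path rcons_path pth1 last_rcons lw /=.
      rewrite rcons_cat cat_path /= pz andbT.
      by move: pthu; rewrite /= rcons_path.
  - by rewrite !mem_cat inE eqxx orbT.
  - move=> v; rewrite !mem_cat mem_rcons !inE mem_cat inE.
    by do !case/orP; move=> ->; rewrite ?orbT.
exists a, z, (rcons p1 w ++ u :: q); split.
- split=> //; rewrite 1?eq_sym //; first by case: (p1).
  split=> //.
  + move=> v; rewrite !mem_cat => /orP[vp|]; last exact: nB.
    by apply: out; move: vp; rewrite mem_rcons mem_cat !inE => /orP[]->; rewrite ?orbT.
  + move: pth2; rewrite /= => /andP[lw _].
    by rewrite rcons_cat cat_path rcons_path pth1 lw last_rcons.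
- by rewrite mem_cat inE eqxx orbT.
- move=> v; rewrite !mem_cat mem_rcons !inE.
  by do !case/orP; move=> ->; rewrite ?orbT.
Qed.

(** As [A :\ w] is connected, it contains a path from [u] back to [B] or to the ear through [w].
    Together with the edge from [w] to [u], this is an ear if [w \in B], and a detour from the given
    ear otherwise. *)
Lemma ear_step A B w u : two_connected A -> B \subset A -> 1 < #|B| ->
  w \in A -> u \in A -> adj w u -> u \notin B ->
  (w \in B \/ exists a b p, [/\ ear B a b p, w \in p & {subset p <= A}]) ->
  exists a b p, [/\ ear B a b p, u \in p & {subset p <= A}].
Proof.
move=> tA BA B1 wA uA wu uB.
have uw : u != w by apply: contraTneq wu => ->; rewrite adj_irrefl.
have conw := two_connected_del (x := w) tA.
have [b0 b0B b0w] : exists2 b0, b0 \in B & b0 != w.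
  have /card_gt0P[b0] : 0 < #|B :\ w| by move: B1; rewrite (cardsD1 w); lia.
  by rewrite !inE => /andP[? ?]; exists b0.
case=> [wB|[a [b [p [eP wp pA]]]]].
  have [||||z [q [zX zA pth un h]]] := path_to_set (X := B :\ w) (u := u) (w := b0) conw.
  - by rewrite !inE uw.
  - by rewrite !inE negb_and uB orbT.
  - by rewrite !inE b0w (subsetP BA).
  - by rewrite !inE b0w.
  have h' v : v \in u :: q -> (v \notin B) && (v \in A).
    by move/h; rewrite !inE => /andP[/andP[-> ->]] /= ->.
  exists w, z, (u :: q); move: zX; rewrite !inE => /andP[zw zB]; split.
  - by split=> //; [rewrite eq_sym | split => //=; [move=> v /h'/andP[]|rewrite wu]].
  - exact: mem_head.
  - by move=> v /h'/andP[].
case: (boolP (u \in p)) => up; first by exists a, b, p.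
case/splitPr: p / wp eP pA up => p1 p2 eP pA up.
set p := p1 ++ w :: p2 in eP pA up *.
have [||||z [q [zX zA pth un h]]] :=
  path_to_set (X := add_ear B p :\ w) (u := u) (w := b0) conw.
- by rewrite !inE uw.
- by rewrite !inE !negb_and !negb_or uB up orbT.
- by rewrite !inE b0w (subsetP BA).
- by rewrite !inE b0w b0B.
have h' v : v \in u :: q -> (v \notin B) && (v \notin p).
  by move/h; rewrite !inE => /andP[/andP[-> _]]; rewrite negb_or.
have hA v : v \in u :: q -> v \in A by move/h; rewrite !inE -andbA => /and3P[].
have fin a' b' p' : ear B a' b' p' /\ u \in p' ->
    {subset p' <= p ++ u :: q} ->
    exists a b p, [/\ ear B a b p, u \in p & {subset p <= A}].
  move=> [e' up'] s'; exists a', b', p'; split=> // v /s'.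
  by rewrite mem_cat => /orP[/pA|/hA].
have wuq : path (@adj G) w (u :: rcons q z) by rewrite /= wu.
have ab : a != b by case: eP.
(* A vertex of [B] differs from [a] or from [b]. In the last two cases the detour is applied to the
   reversed ear. *)
have : z \in p2 \/ z \in B /\ z != a \/ (z \in p1 \/ z \in B /\ z != b).
  move: zX; rewrite /p !inE mem_cat inE => /andP[/negbTE ->] /=.
  case/or3P=> [zB|->|->]; auto.
  by case: (eqVneq z a) zB => [->|za] zB; auto 6.
have dir := ear_detour eP wuq un h'.
case=> [zP|[zP|zP]].
- by have [|a' [b' [p' [*]]]] := dir; [left | exact: (@fin a' b' p')].
- by have [|a' [b' [p' [*]]]] := dir; [right | exact: (@fin a' b' p')].
have := ear_rev eP; rewrite /p rev_cat rev_cons cat_rcons => eP'.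
have Ep : rev p2 ++ w :: rev p1 =i p.
  by move=> v; rewrite /p !mem_cat !inE !mem_rev orbC -orbA; case: (v \in p1); rewrite ?orbT.
have [||a' [b' [p' [e' u' s']]]] := ear_detour eP' wuq un.
- by move=> v /h'; rewrite Ep.
- by rewrite mem_rev.
apply: (@fin a' b' p') => // v /s'; rewrite !(mem_cat v (_ ++ _)) mem_cat.
by rewrite -mem_cat Ep mem_cat.
Qed.

Lemma ear_through A B t : two_connected A -> B \subset A -> 1 < #|B| ->
  t \in A -> t \notin B ->
  exists a b p, [/\ ear B a b p, t \in p & {subset p <= A}].
Proof.
move=> tA BA B1 tA' tB.
have [w wB] : exists w, w \in B by apply/card_gt0P; lia.
have wA := subsetP BA _ wB.
have /connectP[p pth E] := two_connected_connected tA wA tA'.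
(* Along a path from [B] to [t], each vertex is in [B] or on an ear of [B]; [ear_step] carries this
   over every edge. *)
have : w \in B \/ exists a b p, [/\ ear B a b p, w \in p & {subset p <= A}] by left.
elim: p w wA pth E {wB} => [|v p IH] w wA /=.
  by move=> _ E [wB|]; rewrite E // wB in tB *.
case/andP=> /and3P[_ vA wv] pth E hw; apply: (IH v) => //.
case: (boolP (v \in B)) => vB; first by left.
by right; exact: ear_step hw.
Qed.

(** Ears are added to [B] until [A] is exhausted. Vertices placed in [B] beforehand are thus old for
    the last ear, the one to be coloured. *)
Lemma last_ear A B : two_connected A -> two_connected B -> B \proper A ->
  exists B' a b p, [/\ two_connected B', B \subset B', ear B' a b p &
                     A = add_ear B' p].
Proof.
move=> tA; have [n] := ubnP (#|A| - #|B|); elim: n B => // n IH B lt tB.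
move=> /properP[BA [t tA' tB']].
have [a [b [p [eP tp pA]]]] := ear_through tA BA (proj1 tB) tA' tB'.
have BpA : add_ear B p \subset A by exact: add_ear_sub.
case: (eqVneq (add_ear B p) A) => [E|ne]; first by exists B, a, b, p.
have tB2 := two_connected_ear tB eP.
have BB : B \subset add_ear B p by exact: subsetUl.
have BA' : add_ear B p \proper A by rewrite properEneq ne.
have [|B' [a' [b' [p' [tB'' s e' E]]]]] := IH _ _ tB2 BA'.
  have := proper_card BA'; rewrite (card_add_ear eP); case: (eP) => _ _ _ p0 _.
  have : 0 < size p by case: (p) p0. 
  by lia.
by exists B', a', b', p'; split=> //; exact: subset_trans s.
Qed.

End TwoConnected.

(** * The induction *)

Lemma odd_half_ltn n : odd n -> n./2 < n.
Proof. by lia. Qed.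

Section Induction.
Variable G : sgraph.
Implicit Types (A B : {set G}) (u v w x y z a b q r s t : G) (p : seq G).

Lemma connected_neighbour A q : connected_in A -> q \in A -> 1 < #|A| ->
  exists2 u, u \in A & adj q u.
Proof.
move=> conA qA A1.
have /card_gt0P[w] : 0 < #|A :\ q| by move: A1; rewrite (cardsD1 q) qA.
rewrite !inE => /andP[wq wA]; have /connectP[p] := conA q w qA wA.
case: p => [_ E|u p /= /andP[/and3P[_ uA qu] _ _]]; first by rewrite E eqxx in wq.
by exists u.
Qed.

(** A single colour suffices. One of [s] and [t] equals [r], and the empty walk misses this
    colour. *)
Lemma even_colourable2 A : two_connected A -> #|A| = 2 -> even_colourable A.
Proof.
move=> tA A2 r s t rA sA tA' st; exists (fun _ _ => 0); rewrite A2 /=; split=> //.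
  move=> x y xA yA; case: (eqVneq x y) => [->|xy]; first exact: rainbow_walk0.
  have [||u uA xu] := connected_neighbour (q := x) (two_connected_connected tA) => //.
    by rewrite A2.
  suff -> : y = u by exists [:: u]; split=> //=; rewrite /adj_in /= xA uA xu.
  have xu' : x != u by apply: contraTneq xu => ->; rewrite adj_irrefl.
  have : #|A :\ x| <= 1 by move: A2; rewrite (cardsD1 x) xA add1n => -[->].
  by move/card_le1_eqP; apply; rewrite !inE eq_sym ?xy ?xu'.
case: (eqVneq r s) => [->|rs]; first by left; exact: missing0.
right; suff -> : r = t by exact: missing0.
have : #|A :\ s| <= 1 by move: A2; rewrite (cardsD1 s) sA add1n => -[->].
by move/card_le1_eqP; apply; rewrite !inE ?rs // eq_sym st.
Qed.

Lemma even_colourable_edge a b : adj a b -> even_colourable [set a; b].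
Proof.
move=> ab; apply: even_colourable2; first exact: two_connected_edge.
by rewrite cards2; case: eqVneq ab => // ->; rewrite adj_irrefl.
Qed.

Lemma cards_edge a b : adj a b -> #|[set a; b]| = 2.
Proof. by rewrite cards2; case: eqVneq => // ->; rewrite adj_irrefl. Qed.

Section Step.
Variable A : {set G}.
Hypothesis even_IH : forall B, #|B| < #|A| -> two_connected B ->
  ~~ odd #|B| -> even_colourable B.
Hypothesis odd_IH : forall B, #|B| < #|A| -> two_connected B ->
  odd #|B| -> odd_colourable B.

Let card_ear B a b p : ear B a b p -> A = add_ear B p -> #|B| < #|A|.
Proof.
move=> eP ->; rewrite (card_add_ear eP); case: eP => _ _ _ p0 _.
by case: p p0 => //= v p _; rewrite addnS ltnS leq_addr.
Qed.

Let ear_centre B a b p r : ear B a b p -> odd (size p) -> r \in B ->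
  r != nth a p (size p)./2.
Proof.
case=> _ _ _ _ [_ out _] od; apply: contraTneq => ->; apply: out.
by apply: mem_nth; exact: odd_half_ltn.
Qed.

Lemma odd_step B a b p q r s t : two_connected B -> ear B a b p ->
  A = add_ear B p -> odd #|A| -> q \in B -> r \in B -> s \in A -> t \in A ->
  s != t -> odd_claim A q r s t.
Proof.
move=> tB eP E od qB rB sA tA st; have lt := card_ear eP E.
have cE : #|A| = #|B| + size p by rewrite E (card_add_ear eP).
have rA : r \in A by rewrite E inE rB.
have [aB bB ab _ _] := eP.
move: od; rewrite cE oddD; case: (boolP (odd #|B|)) => oB /= op.
  rewrite E in sA tA *; apply: (odd_even_ear eP) => //.
  exact: odd_IH.
have rc := ear_centre eP op rB.
rewrite E in sA tA rA *; apply: (even_odd_ear eP) => //.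
exact: even_IH.
Qed.

Lemma odd_grow B q r s t : two_connected A -> two_connected B -> B \proper A ->
  odd #|A| -> q \in B -> r \in B -> s \in A -> t \in A ->
  s != t -> odd_claim A q r s t.
Proof.
move=> tA tB BA od qB rB sA tA' st.
have [B' [a [b [p [tB' BB' eP E]]]]] := last_ear tA tB BA.
by apply: (odd_step tB' eP) => //; exact: (subsetP BB').
Qed.

(* If [r] is the middle vertex of the ear, turn the base edge of the cycle around
   [q]: this moves the middle vertex. *)
Lemma odd_cycle q q1 p r s t : adj q q1 -> ear [set q; q1] q q1 p ->
  A = add_ear [set q; q1] p -> odd (size p) -> r \in p -> s \in A -> t \in A ->
  s != t -> odd_claim A q r s t.
Proof.
move=> qq1 eP E op rp sA tA st.
have rA : r \in A by rewrite E !inE rp orbT.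
have evK : ~~ odd #|[set q; q1]| by rewrite cards_edge.
case: (eqVneq r (nth q p (size p)./2)) => rc; last first.
  rewrite E in sA tA rA *; apply: (even_odd_ear eP) => //; rewrite ?inE ?eqxx //.
  by apply: even_colourable_edge; rewrite ?inE ?eqxx ?orbT //; case: eP.
have [_ _ qq1' p0 [un out pth]] := eP.
case: p => [|v p] // in eP E op rp rc p0 un out pth *.
move: (pth) => /= /andP[qv pth'].
have q1p : q1 \notin v :: p.
  by apply/negP=> /out; rewrite !inE eqxx orbT.
have qp : q \notin v :: p by apply/negP=> /out; rewrite !inE eqxx.
have un' : uniq (rcons (v :: p) q1) by rewrite rcons_uniq q1p.
(* The same cycle is now based on the edge from [q] to its other neighbour [v]. *)
have eP' : ear [set q; v] v q (rcons p q1).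
  split; rewrite ?inE ?eqxx ?orbT //.
  - by apply: contraNneq qp => ->; rewrite mem_head.
  - by case: (p).
  split.
  - by move: un'; rewrite /= => /andP[].
  - move=> u up; rewrite !inE negb_or; apply/andP; split.
      by apply: contraTneq up => ->; rewrite mem_rcons inE negb_or qq1' /=;
         move: qp; rewrite inE negb_or => /andP[].
    by apply: contraTneq up => ->; move: un'; rewrite /= => /andP[].
  - by rewrite rcons_path pth' last_rcons adj_sym.
have E' : A = add_ear [set q; v] (rcons p q1).
  rewrite E; apply/setP=> u; rewrite !inE mem_rcons inE.
  by case: (u == q); case: (u == q1); case: (u == v); rewrite ?orbT.
have eA : even_claim [set q; v] q v q.
  apply: even_colourable_edge => //; rewrite ?inE ?eqxx ?orbT //.
  by apply: contraNneq qp => ->; rewrite mem_head.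
rewrite E' in sA tA rA *; apply: (even_odd_ear eP') => //.
- by rewrite size_rcons.
- by rewrite cards_edge.
- by rewrite !inE eqxx.
(* Both middle vertices are read off the list [rcons (v :: p) q1]: the new one comes directly after
   the old one, which is [r]. *)
have half := odd_half_ltn op.
rewrite rc size_rcons.
rewrite (_ : nth q (v :: p) _ = nth v (rcons (v :: p) q1) (size (v :: p))./2); last first.
  by rewrite nth_rcons half; exact: set_nth_default.
rewrite (_ : nth v (rcons p q1) _ = nth v (rcons (v :: p) q1) (size (v :: p))./2.+1) //.
by rewrite nth_uniq ?size_rcons ?ltnS ?(ltnW half) // neq_ltn ltnSn.
Qed.

(** An edge at [q] is enlarged by an ear through [r] if necessary. If this is not yet all of [A],
    then [q] and [r] are old for the last ear; otherwise [A] is spanned by an odd cycle and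
    [odd_cycle] applies. *)
Lemma odd_colourable_step : two_connected A -> odd #|A| -> odd_colourable A.
Proof.
move=> tA oA q r s t qA rA sA tA' st.
have [q1 q1A qq1] := connected_neighbour (two_connected_connected tA) qA (proj1 tA).
pose K := [set q; q1]; have cK : #|K| = 2 by exact: cards_edge.
have tK : two_connected K by exact: two_connected_edge.
have KA : K \subset A by apply/subsetP=> u; rewrite !inE => /orP[]/eqP->.
have qK : q \in K by rewrite !inE eqxx.
case: (boolP (r \in K)) => rK.
  apply: (odd_grow tA tK) => //; rewrite properEneq KA andbT.
  by apply: contraTneq oA => <-; rewrite cK.
have [|a [b [p [eP rp pA]]]] := ear_through tA KA _ rA rK; first by rewrite cK.
have KpA : add_ear K p \subset A.
  exact: add_ear_sub.
case: (eqVneq (add_ear K p) A) => [E|ne]; last first.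
  apply: (odd_grow tA (two_connected_ear tK eP)) => //.
  - by rewrite properEneq ne.
  - by rewrite inE qK.
  - by rewrite !inE rp orbT.
have op : odd (size p).
  by move: oA; rewrite -E (card_add_ear eP) cK oddD.
have [aK bK ab _ _] := eP.
have [[Ea Eb]|[Ea Eb]] : (a = q /\ b = q1) \/ (a = q1 /\ b = q).
  move: aK bK ab; rewrite !inE => /orP[]/eqP-> /orP[]/eqP->; rewrite ?eqxx //; auto.
- by subst a b; apply: (odd_cycle qq1 eP).
have eP' := ear_rev eP; subst a b.
by apply: (odd_cycle qq1 eP'); rewrite ?add_ear_rev ?size_rev ?mem_rev.
Qed.

(** If [#|B|] is odd, so is the ear, and [odd_odd_ear] asks for a second vertex [t'] of [B] besides
    [s]: any will do if the ear has several inner vertices, but it has to be [t] if there is only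
    one. *)
Lemma even_step B a b p r s t : two_connected B -> ear B a b p ->
  A = add_ear B p -> ~~ odd #|A| -> r \in B -> s \in B -> t \in A -> s != t ->
  [\/ ~~ odd #|B|, 1 < size p | t \in B] -> even_claim A r s t.
Proof.
move=> tB eP E ev rB sB tA st alt; have lt := card_ear eP E.
have cE : #|A| = #|B| + size p by rewrite E (card_add_ear eP).
have rA : r \in A by rewrite E inE rB.
have sA : s \in A by rewrite E inE sB.
have [aB bB ab _ _] := eP.
move: ev; rewrite cE oddD; case: (boolP (odd #|B|)) => oB /= op; last first.
  rewrite E in sA tA rA *; apply: (even_even_ear eP) => //.
  exact: even_IH.
rewrite negbK in op.
have [t' [t'B st' alt']] : exists t', [/\ t' \in B, s != t' & 1 < size p \/ t' = t].
  case: alt => [|p1|tB']; first by rewrite oB.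
    have /card_gt0P[t'] : 0 < #|B :\ s|.
      by have := proj1 tB; rewrite (cardsD1 s) sB.
    by rewrite !inE => /andP[ts t'B]; exists t'; split=> //; [rewrite eq_sym|left].
  by exists t; split=> //; right.
rewrite E; apply: (odd_odd_ear eP op oB _ rB sB alt').
exact: odd_IH.
Qed.

Lemma even_grow B r s t : two_connected A -> two_connected B -> B \proper A ->
  ~~ odd #|A| -> r \in B -> s \in B -> t \in B -> s != t -> even_claim A r s t.
Proof.
move=> tA tB BA ev rB sB tB' st.
have [B' [a [b [p [tB2 BB' eP E]]]]] := last_ear tA tB BA.
have BA' := proper_sub BA.
apply: (even_step tB2 eP) => //; try exact: (subsetP BB').
- exact: (subsetP BA').
- by apply: Or33; exact: (subsetP BB').
Qed.

(** The vertices [v], [a], [s2], [b] form an even cycle [H], which is the edge between [a] and [v]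
    with an even ear; [s1], unless empty, is an even ear of [H]. Either way [v] is old for the last
    ear, as [even_even_ear_inner] demands. *)
Lemma even_theta_arc a b (s1 s2 : seq G) v r s : adj a v -> adj b v ->
  uniq (a :: s1 ++ b :: s2) -> path (@adj G) a (rcons (s1 ++ b :: s2) a) ->
  v \notin a :: s1 ++ b :: s2 -> A =i v :: a :: s1 ++ b :: s2 ->
  ~~ odd (size s1) -> odd (size s2) -> r \in A -> s \in A -> s != v ->
  even_claim A r s v.
Proof.
move=> av bv un pth vs E ev od rA sA sv.
have tH : two_connected [set a; v] by exact: two_connected_edge.
have cH := cards_edge av.
move: pth; rewrite rcons_cat cat_path /= => /and3P[pth1 ab' pth2].
have path1 : path (@adj G) a (rcons s1 b) by rewrite rcons_path pth1.
have path2 : path (@adj G) a (rcons (rev s2) b).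
  have := rev_path (@adj G) b (rcons s2 a).
  rewrite last_rcons belast_rcons rev_cons => ->.
  by rewrite (eq_path (e' := @adj G)) // => u w; rewrite adj_sym.
move: un; rewrite /= mem_cat inE cat_uniq /= !negb_or => /andP[/and3P[as1 ab as2]].
case/and3P=> us1 /andP[bs1 /hasPn ds] /andP[bs2 us2].
move: vs; rewrite inE mem_cat inE !negb_or => /andP[va /and3P[vs1 vb vs2]].
have eP : ear [set a; v] a v (rcons (rev s2) b).
  split; rewrite ?inE ?eqxx ?orbT //.
  - by rewrite eq_sym.
  - by case: (rev s2).
  split.
  - by rewrite rcons_uniq mem_rev bs2 rev_uniq.
  - move=> u; rewrite mem_rcons inE mem_rev !inE negb_or => /orP[/eqP->|us].
      by rewrite eq_sym ab eq_sym vb.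
    by apply/andP; split; apply: contraTneq us => ->.
  - by rewrite rcons_path path2 last_rcons.
have evp : ~~ odd (size (rcons (rev s2) b)) by rewrite size_rcons size_rev /= od.
set H := add_ear [set a; v] (rcons (rev s2) b).
have tH' : two_connected H := two_connected_ear tH eP.
have HE u : (u \in H) = (u == v) || (u == a) || (u == b) || (u \in s2).
  rewrite !inE mem_rcons inE mem_rev.
  by case: (u == a); case: (u == v); case: (u == b).
have cH' : #|H| = 2 + (size s2).+1 by rewrite (card_add_ear eP) cH size_rcons size_rev.
case: s1 => [|w s1] in E ev as1 us1 bs1 ds vs1 path1 pth1 ab' *.
  have EA : A = H by apply/setP=> u; rewrite HE E !inE !orbA.
  rewrite EA in rA sA *; apply: (even_even_ear_inner eP) => //.
    exact: even_colourable_edge.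
  by rewrite !inE eqxx orbT.
have eP' : ear H a b (w :: s1).
  split=> //; try by rewrite HE eqxx ?orbT.
  split=> // u us; rewrite HE !negb_or -!andbA; apply/and4P; split.
  - by apply: contraTneq us => ->.
  - by apply: contraTneq us => ->.
  - by apply: contraTneq us => ->.
  - by apply/negP=> /ds; rewrite us.
have EA : A = add_ear H (w :: s1).
  apply/setP=> u; rewrite [RHS]in_setU HE E !inE mem_cat inE.
  case: (u == v); case: (u == a); case: (u == b); case: (u == w) => //=;
  by case: (u \in s1); rewrite ?orbT ?orbF.
have lt : #|H| < #|A| := card_ear eP' EA.
rewrite EA in rA sA *; apply: (even_even_ear_inner eP') => //.
  by apply: even_IH => //; rewrite cH' /= od.
by rewrite HE eqxx.
Qed.

(* The vertices of [K] and [p0] form an odd cycle, on which [a] and [b] cut two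
   arcs, one with an even number of inner vertices. The other arc and [v] form
   an even cycle, of which this arc is an ear. *)
Lemma even_theta K a0 b0 p0 a b v r s : K = [set a0; b0] -> adj a0 b0 ->
  ear K a0 b0 p0 -> ear (add_ear K p0) a b [:: v] -> odd (size p0) ->
  A = add_ear (add_ear K p0) [:: v] -> r \in A -> s \in A -> s != v ->
  even_claim A r s v.
Proof.
move=> EK ab0 eP0 eP od E rA sA sv.
have un0 := ear_uniq eP0; set c0 := a0 :: rcons p0 b0 in un0.
have cyc0 : cycle (@adj G) c0.
  rewrite /c0 /= rcons_path last_rcons adj_sym ab0 andbT.
  by case: eP0 => _ _ _ _ [_ _].
have KE u : (u \in add_ear K p0) = (u \in c0).
  by rewrite EK !inE mem_rcons inE -!orbA orbCA.
have [aB bB ab _ [_ out /= /and3P[av vb _]]] := eP.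
have vB : v \notin c0 by rewrite -KE out // mem_head.
have bv : adj b v by rewrite adj_sym.
rewrite !KE in aB bB.
case: (rot_to aB) => i c1 rotE.
have b1 : b \in c1.
  by move: bB; rewrite -(mem_rot i) rotE inE eq_sym (negbTE ab).
have un1 : uniq (a :: c1) by rewrite -rotE rot_uniq.
have cyc1 : cycle (@adj G) (a :: c1) by rewrite -rotE rot_cycle.
have E1 : A =i v :: a :: c1.
  move=> u; rewrite E in_setU KE -(mem_rot i) rotE !inE.
  by case: (u == v); rewrite ?orbT ?orbF.
have v1 : v \notin a :: c1 by rewrite -rotE mem_rot.
have od1 : odd (size (a :: c1)) by rewrite -rotE size_rot /c0 /= size_rcons /= od.
case/splitPr: b1 un1 cyc1 E1 v1 od1 {rotE} => s1 s2 un1 cyc1 E1 v1.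
rewrite /= size_cat /= addnS /= oddD negbK.
case: (boolP (odd (size s1))) => o1 /= o2; last first.
  exact: (even_theta_arc av bv un1 cyc1 v1 E1).
(* Starting the cycle at [b] interchanges the two arcs. *)
have rotE : rot (size (a :: s1)) (a :: s1 ++ b :: s2) = b :: s2 ++ a :: s1.
  by rewrite -cat_cons rot_size_cat.
apply: (@even_theta_arc b a s2 s1) => //.
- by rewrite -rotE rot_uniq.
- by rewrite -[path _ _ _]/(cycle _ (b :: s2 ++ a :: s1)) -rotE rot_cycle.
- by rewrite -rotE mem_rot.
- by move=> u; rewrite E1 [LHS]in_cons -(mem_rot (size (a :: s1)) (a :: _)) rotE.
Qed.

(** An edge at [r] is enlarged by an ear through [s] and one through [t], as far as needed. If [A]
    is not exhausted, all three are old for the last ear. If the ear through [t] is the last one,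
    [even_step] applies, unless this ear is [t] alone on an odd cycle; that case is [even_theta]. *)
Lemma even_colourable_step : two_connected A -> ~~ odd #|A| -> even_colourable A.
Proof.
move=> tA evA r s t rA sA tA' st.
have [r1 r1A rr1] := connected_neighbour (two_connected_connected tA) rA (proj1 tA).
pose K := [set r; r1]; have cK : #|K| = 2 by exact: cards_edge.
have tK : two_connected K by exact: two_connected_edge.
have KA : K \subset A by apply/subsetP=> u; rewrite !inE => /orP[]/eqP->.
have rK : r \in K by rewrite !inE eqxx.
(* [B] is an edge or a cycle *)
have main B : two_connected B -> B \proper A -> r \in B -> s \in B ->
    (odd #|B| -> exists a0 b0 p0,
       [/\ K = [set a0; b0], adj a0 b0, ear K a0 b0 p0 & B = add_ear K p0]) ->
    even_claim A r s t.
  move=> tB BA rB sB cyc.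
  case: (boolP (t \in B)) => tB'; first exact: (even_grow tA tB BA).
  have BA' := proper_sub BA.
  have [a [b [p [eP tp pA]]]] := ear_through tA BA' (proj1 tB) tA' tB'.
  case: (eqVneq (add_ear B p) A) => [E|ne]; last first.
    apply: (even_grow tA (two_connected_ear tB eP)) => //.
    - by rewrite properEneq ne add_ear_sub.
    - by rewrite inE rB.
    - by rewrite inE sB.
    - by rewrite !inE tp orbT.
  case: (boolP (odd #|B|)) => oB; last by apply: (even_step tB eP) => //; apply: Or31.
  case: (ltnP 1 (size p)) => p1; first by apply: (even_step tB eP) => //; apply: Or32.
  have [v Ep] : exists v, p = [:: v].
    by case: p p1 eP tp {E pA} => [|v [|? ?]] //= *; exists v.
  subst p; move: tp; rewrite inE => /eqP E'; subst v.
  have [a0 [b0 [p0 [EK ab0 eP0 EB]]]] := cyc oB; subst B.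
  apply: (even_theta EK ab0 eP0 eP) => //.
  by move: oB; rewrite (card_add_ear eP0) cK oddD.
case: (boolP (s \in K)) => sK.
  case: (eqVneq K A) => [EK|ne].
    by apply: even_colourable2 => //; rewrite -EK.
  by apply: (main K) => //; rewrite ?properEneq ?ne ?cK.
have [|a [b [p [eP sp pA]]]] := ear_through tA KA _ sA sK; first by rewrite cK.
have [aK bK ab _ _] := eP.
case: (eqVneq (add_ear K p) A) => [E|ne].
  have ep : ~~ odd (size p).
    by move: evA; rewrite -E (card_add_ear eP) cK oddD.
  rewrite -E in sA tA' *; apply: (even_even_ear eP) => //.
  exact: even_colourable_edge.
apply: (main (add_ear K p)).
- exact: two_connected_ear eP.
- by rewrite properEneq ne add_ear_sub.
- by rewrite inE rK.
- by rewrite !inE sp orbT.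
move=> _; exists a, b, p.
move: aK bK ab; rewrite !inE => /orP[]/eqP Ea /orP[]/eqP Eb; subst a b;
  rewrite ?eqxx // => _; split=> //.
- by rewrite setUC.
- by rewrite adj_sym.
Qed.

End Step.

Lemma two_connected_colourable A : two_connected A ->
  (odd #|A| -> odd_colourable A) /\ (~~ odd #|A| -> even_colourable A).
Proof.
have [n] := ubnP #|A|; elim: n A => // n IH A; rewrite ltnS => An tA.
have ltn B : #|B| < #|A| -> #|B| < n by move=> lt; exact: leq_trans An.
split=> par.
  by apply: odd_colourable_step => // B lt tB; have [] := IH B (ltn B lt) tB.
by apply: even_colourable_step => // B lt tB; have [] := IH B (ltn B lt) tB.
Qed.

End Induction.

(** * From walks to paths, and from colours of pairs to colours of edges *)

Section EdgeColouring.
Variable G : sgraph.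
Implicit Types (c : G -> G -> nat) (u v x y : G) (p : seq G).

(** The colours are a subsequence of the old ones, so a rainbow walk shortens to a rainbow path with
    no further colours. *)
Lemma shorten_walk c x p : path (@adj G) x p ->
  exists p', [/\ path (@adj G) x p', last x p' = last x p, uniq (x :: p') &
                 subseq (pairmap c x p') (pairmap c x p)].
Proof.
elim: p x => [|u p IH] x; first by exists [::].
case/andP=> xu /IH[p' [pth lst un sub]]; rewrite [last _ _]/=.
have {}sub : subseq (pairmap c x (u :: p')) (pairmap c x (u :: p)).
  by rewrite /= eqxx.
move: (pairmap c x (u :: p)) sub => cols sub.
have {xu}pth : path (@adj G) x (u :: p') by rewrite /= xu.
rewrite -[last u p']/(last x (u :: p')) in lst.
case: (boolP (x \in u :: p')) => xp; last first.
  by exists (u :: p'); rewrite cons_uniq xp.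
move: pth lst un sub; case/splitPr: xp => p1 p2.
rewrite cat_path last_cat pairmap_cat cat_uniq /= => /and3P[_ _ pth] lst.
case/and3P=> _ _ un sub; exists p2; split=> //; rewrite -?lst //.
by apply: subseq_trans sub; rewrite -cat_rcons suffix_subseq.
Qed.

Lemma set2_inj c u v u' v' : commutative c ->
  [set u; v] = [set u'; v'] -> c u v = c u' v'.
Proof.
move=> cC E; have : u \in [set u'; v'] by rewrite -E set21.
have : v \in [set u'; v'] by rewrite -E set22.
have : u' \in [set u; v] by rewrite E set21.
have : v' \in [set u; v] by rewrite E set22.
rewrite !inE => hv' hu' /orP[]/eqP ev /orP[]/eqP eu; subst u v => //.
- by move: hv'; rewrite orbb => /eqP->.
- by move: hu'; rewrite orbb => /eqP->.
Qed.

Lemma walk_colourable c k : 0 < k -> commutative c -> rainbow_conn c [set: G] k ->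
  rainbow_colourable G k.
Proof.
move=> k0 cC rc.
pose ce (f : edge G) := if [pick uv : G * G | val f == [set uv.1; uv.2]] is Some uv
  then c uv.1 uv.2 else 0.
have ceE f u v : val f = [set u; v] -> ce f = c u v.
  move=> fE; rewrite /ce; case: pickP => [uv /eqP E|/(_ (u, v))].
    by apply: set2_inj => //; rewrite -E.
  by rewrite /= fE eqxx.
(* Edges off the chosen walks may have colours from [k] on. Reduction modulo [k] brings them into
   range and fixes the colours below [k]. *)
exists (fun f => Ordinal (ltn_pmod (ce f) k0)) => x y.
have [p [pth lst un al]] := rc x y (in_setT x) (in_setT y).
have [|p' [pth' lst' un' sub]] := @shorten_walk c x p.
  by apply: sub_path pth => u v /and3P[].
exists p'; split; first by split=> //; rewrite lst'.
(* Edges of the path are traced back to their positions: as the colour sequence has no repetition,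
   equal colours force equal positions. *)
have pos f : f \in path_edges x p' -> exists2 i, i < size p' &
    val f = [set nth x (x :: p') i; nth x p' i] /\ ce f = nth 0 (pairmap c x p') i.
  rewrite inE => /(nthP set0)[i]; rewrite size_pairmap => ip.
  rewrite (nth_pairmap x) // => fE; exists i => //; split=> //.
  by rewrite (nth_pairmap x) //; exact: ceE.
move=> f g /pos[i ip [fE cf]] /pos[j jp [gE cg]] /(congr1 val) /=.
have lt n : n < size p' -> nth 0 (pairmap c x p') n < k.
  move=> np; apply: (allP al); apply: (mem_subseq sub).
  by rewrite mem_nth // size_pairmap.
rewrite cf cg !modn_small ?lt // => /eqP.
rewrite nth_uniq ?size_pairmap //; last exact: subseq_uniq un.
by move/eqP=> ij; apply: val_inj; rewrite fE gE ij.
Qed.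

End EdgeColouring.

Theorem theorem2 (G : sgraph) (n : nat) (hn : #|G| = n)
  (h2 : k_connected G 2) : rc G <= uphalf n.
Proof.
have [_ minrc] := rcP (k_connected_connected (isT : 0 < 2) h2).
apply: minrc; case: h2 => n2 con.
have tG : two_connected [set: G].
  split; first by rewrite cardsT ltnW.
  by move=> X /con; rewrite setTD.
have /card_gt0P[a _] : 0 < #|G| by exact: leq_trans n2.
have [c [cC rc]] : exists c : G -> G -> nat,
    commutative c /\ rainbow_conn c [set: G] (uphalf #|[set: G]|).
  (* Only rainbow connectedness is wanted now, so any prescribed vertices will do; a second vertex
     [b] provides the distinct pair. *)
  have /card_gt0P[b] : 0 < #|[set: G] :\ a|.
    by move: n2; rewrite -cardsT (cardsD1 a) inE; lia.
  rewrite !inE andbT eq_sym => ab.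
  have [oc ec] := two_connected_colourable tG.
  case: (boolP (odd #|[set: G]|)) => [/oc|/ec] h.
    have [c [cC rc _ _]] := h a a a b (in_setT a) (in_setT a) (in_setT a) (in_setT b) ab.
    by exists c.
  have [c [cC rc _]] := h a a b (in_setT a) (in_setT a) (in_setT b) ab.
  by exists c.
rewrite cardsT in rc; rewrite -hn; apply: walk_colourable cC rc.
by rewrite uphalf_gt0 (leq_trans _ n2).
Qed.
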